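(* Let $A\in\mathbb{R}^{n\times n}$ be a fixed matrix and let $\{B_k\}$ be generated from an initial matrix $B_0\in\mathbb{R}^{n\times n}$ by one of the three update rules described in the context (Broyden family, generalized PSB family, BGM), with nonzero correction directions $s_k$ and $y_k=As_k$. Suppose that at each step $k$ (as long as $B_k\neq A$) a nonzero direction $s_k\in\ker(B_k-A)^{\perp_W}$ is chosen, where $W$ is the symmetric positive definite matrix associated with the update rule as follows: (i) Broyden family: $W=A$ at every step, or $W=B_k$ at every step $k$; (ii) generalized PSB family with symmetric nonsingular parameter matrix $M$: $W=M^{-2}$; (iii) BGM: $W=I$. Then the process reaches $A$ in at most $n$ steps, i.e. $B_m=A$ for some $m\le n$ (so $B_n=A$, with the convention that $B_k$ is left unchanged once it equals $A$).
   Context: For a symmetric positive definite $W\in\mathbb{R}^{n\times n}$ put $\langle a,b\rangle_W=a^\top W b$; for a subspace $V$, $V^{\perp_W}=\{z\in\mathbb{R}^n: \langle z,x\rangle_W=0\ \forall x\in V\}$. In the choices $W=A$ or $W=B_k$ these matrices are understood to be symmetric positive definite. Matrix approximation process: at step $k$ one takes $s_k\in\mathbb{R}^n\setminus\{0\}$, sets $y_k=As_k$, and computes $B_{k+1}$ from $B_k$, so that $B_{k+1}s_k=y_k$, by one of the following rules. Broyden family (fixed real parameter $\theta$; $A$ and all $B_k$ symmetric): $$B_{k+1}=B_k+\frac{y_ky_k^\top}{s_k^\top y_k}-\frac{B_ks_ks_k^\top B_k}{s_k^\top B_ks_k}+\theta\,\omega_k\omega_k^\top,\qquad \omega_k=\sqrt{s_k^\top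 B_ks_k}\left(\frac{y_k}{s_k^\top y_k}-\frac{B_ks_k}{s_k^\top B_ks_k}\right),$$ where the update is assumed well defined ($s_k^\top y_k\ne0$, $s_k^\top B_ks_k>0$). Generalized PSB family (fixed symmetric nonsingular $M\in\mathbb{R}^{n\times n}$; $A$ and all $B_k$ symmetric): with $r_k=y_k-B_ks_k$, $$B_{k+1}=B_k+\frac{r_ks_k^\top M^{-2}+M^{-2}s_kr_k^\top}{s_k^\top M^{-2}s_k}-\frac{s_k^\top r_k}{(s_k^\top M^{-2}s_k)^2}M^{-2}s_ks_k^\top M^{-2}.$$ BGM (Broyden's ''good'' method; no symmetry of $A$ or $B_k$ required): $$B_{k+1}=B_k+\frac{(y_k-B_ks_k)s_k^\top}{s_k^\top s_k}.$$ *)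

(* Defs.v *)
From mathcomp Require Import all_boot all_order all_algebra.
From mathcomp Require Import classical_sets reals.

Set Implicit Arguments.
Unset Strict Implicit.
Unset Printing Implicit Defensive.

Import Order.TTheory GRing.Theory Num.Theory.

Local Open Scope classical_set_scope.
Local Open Scope ring_scope.

Section QuasiNewton.
Variables (R : realType) (n : nat).
Implicit Types (A B M W : 'M[R]_n) (a b s y x z : 'cV[R]_n).

Definition wdot W a b : R := (a^T *m W *m b) 0 0.

Definition dot a b : R := (a^T *m b) 0 0.

Definition is_symmetric_mx M : Prop := M^T = M.

Definition spd W : Prop :=
  is_symmetric_mx W /\ (forall x, x != 0 -> 0 < wdot W x x).

(* Kernel for the action on column vectors; mxalgebra's [kermx] is the kernel
   for the action on row vectors. *)
Definition colker M : set 'cV[R]_n := [set x | M *m x = 0].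

Definition perp W (V : set 'cV[R]_n) : set 'cV[R]_n :=
  [set z | forall x, V x -> wdot W z x = 0].

(* 'M[R]_n is not a ring with inverses for arbitrary n, hence no [M ^- 2]. *)
Definition invsq M : 'M[R]_n := invmx M *m invmx M.

Definition broyden_well_defined B s y : Prop :=
  dot s y != 0 /\ 0 < wdot B s s.

Definition broyden_omega B s y : 'cV[R]_n :=
  Num.sqrt (wdot B s s) *:
    ((dot s y)^-1 *: y - (wdot B s s)^-1 *: (B *m s)).

Definition broyden_update (theta : R) B s y : 'M[R]_n :=
  B + (dot s y)^-1 *: (y *m y^T)
    - (wdot B s s)^-1 *: (B *m s *m s^T *m B)
    + theta *: (broyden_omega B s y *m (broyden_omega B s y)^T).

Definition psb_update M B s y : 'M[R]_n :=
  let N := invsq M in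
  let r := y - B *m s in
  B + (wdot N s s)^-1 *: (r *m s^T *m N + N *m s *m r^T)
    - (dot s r / wdot N s s ^+ 2) *: (N *m s *m s^T *m N).

Definition bgm_update B s y : 'M[R]_n :=
  B + (dot s s)^-1 *: ((y - B *m s) *m s^T).

(* The metric [W] may vary with the step; no constraint is put on a step at
   which the target [A] is already reached. *)
Definition admissible_directions A (W B : nat -> 'M[R]_n)
    (s : nat -> 'cV[R]_n) : Prop :=
  forall k, B k <> A -> s k != 0 /\ perp (W k) (colker (B k - A)) (s k).

Definition generated_by (update : 'M[R]_n -> 'cV[R]_n -> 'cV[R]_n -> 'M[R]_n)
    A (B : nat -> 'M[R]_n) (s : nat -> 'cV[R]_n) : Prop :=
  forall k, B k <> A -> B k.+1 = update (B k) (s k) (A *m s k).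

(* The second clause reads off [B n] when the sequence is continued as a
   constant from the first step at which it equals [A]. *)
Definition reaches_within_dim A (B : nat -> 'M[R]_n) : Prop :=
  (exists2 m : nat, (m <= n)%N & B m = A) /\
  ((forall k, B k = A -> B k.+1 = A) -> B n = A).

End QuasiNewton.

(* Main.v *)
(* Put E_k = B_k - A.  If x is in ker E_k, then s_k is W-orthogonal to x, and this
   annihilates every term of the update applied to x, so ker E_k is contained in
   ker E_{k+1}.  The secant equation puts s_k in ker E_{k+1}, while s_k is not
   in ker E_k, as it would then be W-orthogonal to itself.  So the rank of E_k
   decreases strictly until it is zero. *)
Require Import Defs.
From mathcomp Require Import all_boot all_order all_algebra.
From mathcomp Require Import classical_sets reals.

Set Implicit Arguments.
Unset Strict Implicit.
Unset Printing Implicit Defensive.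

Import Order.TTheory GRing.Theory Num.Theory.

Local Open Scope ring_scope.

(** The row space of a matrix is the annihilator of its column kernel, so a larger kernel means a
    smaller row space. The vector [s] makes the inclusion strict: [E = D *m E'] would force
    [E *m s = 0]. *)
Lemma mxrank_lt_colker (F : fieldType) (m n : nat) (E E' : 'M[F]_(m, n))
    (s : 'cV[F]_n) :
  (forall x : 'cV[F]_n, E *m x = 0 -> E' *m x = 0) ->
  E' *m s = 0 -> E *m s <> 0 -> (\rank E' < \rank E)%N.
Proof.
move=> kerS E's Es; apply: rank_ltmx; rewrite ltmxE; apply/andP; split.
  rewrite submxE; apply/eqP/matrixP => i j.
  (* The columns of [cokermx E] lie in the column kernel of [E], so [E'] annihilates them too, which
     is the criterion of [submxE]. *)
  have /kerS /matrixP/(_ i 0) : E *m col j (cokermx E) = 0.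
    by rewrite colE mulmxA mulmx_coker mul0mx.
  by rewrite colE mulmxA -colE !mxE.
by apply/negP => /submxP[D EE']; apply: Es; rewrite EE' -mulmxA E's mulmx0.
Qed.

Section FiniteTermination.
Variables (R : realType) (n : nat).
Implicit Types (A B M N W : 'M[R]_n) (s x y u v : 'cV[R]_n).

Lemma reaches_within_dim_of_mxrank A (B : nat -> 'M[R]_n) :
  (forall k, B k <> A -> (\rank (B k.+1 - A)%R < \rank (B k - A)%R)%N) ->
  reaches_within_dim A B.
Proof.
move=> rank_lt.
have reach : exists2 m : nat, (m <= n)%N & B m = A.
  (* Each step taken before reaching [A] lowers the rank by at least one, starting from at most [n].
     At [k = n] the second alternative leaves rank zero. *)
  have rank_or k : (exists2 m : nat, (m < k)%N & B m = A) \/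
                   (\rank (B k - A)%R + k <= n)%N.
    elim: k => [|k [[m lt_mk BmA]|IHk]].
    - by right; rewrite addn0 rank_leq_row.
    - by left; exists m => //; apply: ltnW.
    - have [BkA|/eqP BkA] := eqVneq (B k) A; first by left; exists k.
      by right; rewrite addnS -addSn (leq_trans _ IHk) // leq_add2r rank_lt.
  have [[m lt_mn BmA]|] := rank_or n; first by exists m => //; apply: ltnW.
  rewrite -[X in (_ <= X)%N]add0n leq_add2r leqn0 mxrank_eq0 subr_eq0 => /eqP.
  by exists n.
split=> // stay; have [m le_mn BmA] := reach.
suff BA d : B (d + m)%N = A by rewrite -(BA (n - m)%N) subnK.
by elim: d => // d; apply: stay.
Qed.

(** Common interface for the three rules: each has only to supply its secant equation, a nonzero
    [wdot (W k) (s k) (s k)], and invariance on the kernel vectors orthogonal to [s k]. *)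
Lemma reaches_within_dim_of_secant A (W B : nat -> 'M[R]_n)
    (s : nat -> 'cV[R]_n) :
  admissible_directions A W B s ->
  (forall k, B k <> A -> wdot (W k) (s k) (s k) != 0) ->
  (forall k, B k <> A -> B k.+1 *m s k = A *m s k) ->
  (forall k x, B k <> A -> B k *m x = A *m x -> wdot (W k) (s k) x = 0 ->
     B k.+1 *m x = B k *m x) ->
  reaches_within_dim A B.
Proof.
move=> adm Wss secant fix_ker; apply: reaches_within_dim_of_mxrank => k BkA.
have [_ perp_s] := adm k BkA.
apply: (@mxrank_lt_colker _ _ _ _ _ (s k)) => [x Ex||Es].
- have Bx : B k *m x = A *m x by apply/subr0_eq; rewrite -mulmxBl.
  by rewrite mulmxBl fix_ker ?Bx ?subrr //; apply: perp_s.
- by rewrite mulmxBl secant ?subrr.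
- by move/eqP: (Wss k BkA); apply; apply: perp_s.
Qed.

Lemma mul_outer (u v x : 'cV[R]_n) : u *m v^T *m x = dot v x *: u.
Proof. by rewrite -mulmxA [v^T *m x]mx11_scalar mul_mx_scalar. Qed.

Lemma mul_outer_mx (u s x : 'cV[R]_n) N : u *m s^T *m N *m x = wdot N s x *: u.
Proof.
by rewrite -!mulmxA [s^T *m _]mx11_scalar mul_mx_scalar mulmxA.
Qed.

Lemma dot_mulmx s x N : dot s (N *m x) = wdot N s x.
Proof. by rewrite /dot mulmxA. Qed.

Lemma dot_mulmxl s x N : is_symmetric_mx N -> dot (N *m s) x = wdot N s x.
Proof. by move=> symN; rewrite /dot trmx_mul symN. Qed.

Lemma dotC u v : dot u v = dot v u.
Proof. by rewrite /dot -[u^T *m v]trmxK trmx_mul trmxK mxE. Qed.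

Lemma dotBl u v x : dot (u - v) x = dot u x - dot v x.
Proof. by rewrite /dot linearB mulmxBl !mxE. Qed.

Lemma dotZl c u x : dot (c *: u) x = c * dot u x.
Proof. by rewrite /dot linearZ -scalemxAl mxE. Qed.

Lemma dot_gt0 u : u != 0 -> 0 < dot u u.
Proof.
have dotE : dot u u = \sum_i u i 0 ^+ 2.
  by rewrite /dot mxE; apply: eq_bigr => i _; rewrite mxE expr2.
rewrite dotE lt0r sumr_ge0 ?andbT => [|i _]; last exact: sqr_ge0.
apply: contra_neq => /psumr_eq0P sum0; apply/matrixP => i j; rewrite ord1 mxE.
by apply/eqP; rewrite -sqrf_eq0 sum0 // => l _; exact: sqr_ge0.
Qed.

(** By symmetry of [M], this is the squared Euclidean norm of [invmx M *m s]. *)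
Lemma wdot_invsq_gt0 M s :
  is_symmetric_mx M -> M \in unitmx -> s != 0 -> 0 < wdot (invsq M) s s.
Proof.
move=> symM uM s0.
have -> : wdot (invsq M) s s = dot (invmx M *m s) (invmx M *m s).
  by rewrite /wdot /dot /invsq trmx_mul trmx_inv symM !mulmxA.
by apply: dot_gt0; apply: contra_neq s0 => Ms0; rewrite -(mulKVmx uM s) Ms0 mulmx0.
Qed.

Lemma broyden_update_mul theta B s y x :
  broyden_update theta B s y *m x =
    B *m x + (dot s y)^-1 *: (dot y x *: y)
      - (wdot B s s)^-1 *: (wdot B s x *: (B *m s))
      + theta *: (dot (broyden_omega B s y) x *: broyden_omega B s y).
Proof.
rewrite /broyden_update; move: (broyden_omega B s y) => w.
by rewrite !(mulmxDl, mulNmx) -!scalemxAl !mul_outer mul_outer_mx.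
Qed.

Lemma dot_broyden_omega B s y x :
  is_symmetric_mx B ->
  dot (broyden_omega B s y) x = Num.sqrt (wdot B s s) *
    ((dot s y)^-1 * dot y x - (wdot B s s)^-1 * wdot B s x).
Proof. by move=> symB; rewrite /broyden_omega dotZl dotBl !dotZl dot_mulmxl. Qed.

(** Both quotients in [broyden_omega] pair with [s] to 1, so the [theta] term vanishes at [s]; the
    second rank-one term then cancels [B *m s]. *)
Lemma broyden_secant theta B s y :
  is_symmetric_mx B -> broyden_well_defined B s y ->
  broyden_update theta B s y *m s = y.
Proof.
move=> symB [sy0 sBs_gt0]; have sBs0 := lt0r_neq0 sBs_gt0.
rewrite broyden_update_mul dot_broyden_omega // (dotC y s) !scalerA !mulVf //.
by rewrite subrr !mulr0 mul0r !scale1r scale0r addr0 addrAC subrr add0r.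
Qed.

Lemma broyden_fix theta B s y x :
  is_symmetric_mx B -> dot y x = 0 -> wdot B s x = 0 ->
  broyden_update theta B s y *m x = B *m x.
Proof.
move=> symB yx sBx; rewrite broyden_update_mul dot_broyden_omega // yx sBx.
by rewrite !mulr0 subrr !mulr0 !scale0r !scaler0 subr0 !addr0.
Qed.

Lemma psb_update_mul M B s y x :
  let N := invsq M in let r := y - B *m s in
  psb_update M B s y *m x =
    B *m x + (wdot N s s)^-1 *: (wdot N s x *: r + dot r x *: (N *m s))
      - (dot s r / wdot N s s ^+ 2) *: (wdot N s x *: (N *m s)).
Proof.
rewrite /psb_update; move: (invsq M) (y - B *m s) => N r /=.
by rewrite !(mulmxDl, mulNmx) -!scalemxAl mulmxDl mul_outer !mul_outer_mx.
Qed.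

(** At [s] the last correction cancels the [N *m s] part of the first one, leaving
    [B *m s + r = y]. *)
Lemma psb_secant M B s y :
  wdot (invsq M) s s != 0 -> psb_update M B s y *m s = y.
Proof.
move=> sNs0; rewrite psb_update_mul scalerDr !scalerA mulVf // scale1r.
rewrite expr2 invfM mulrA divfK // (dotC s) [_^-1 * _]mulrC addrA addrK.
by rewrite addrC subrK.
Qed.

Lemma psb_fix M B s y x :
  wdot (invsq M) s x = 0 -> dot (y - B *m s) x = 0 ->
  psb_update M B s y *m x = B *m x.
Proof.
move=> sNx rx; rewrite psb_update_mul sNx rx.
by rewrite !scale0r addr0 !scaler0 addr0 subr0.
Qed.

Lemma bgm_update_mul B s y x :
  bgm_update B s y *m x = B *m x + (dot s s)^-1 *: (dot s x *: (y - B *m s)).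
Proof. by rewrite /bgm_update mulmxDl -scalemxAl mul_outer. Qed.

End FiniteTermination.

Theorem proposition2p1 (R : realType) (n : nat) (A : 'M[R]_n)
    (B : nat -> 'M[R]_n) (s : nat -> 'cV[R]_n) :
  (forall (theta : R) (W : nat -> 'M[R]_n),
     (forall k, W k = A) \/ (forall k, W k = B k) ->
     is_symmetric_mx A ->
     (forall k, is_symmetric_mx (B k)) ->
     (forall k, B k <> A -> spd (W k)) ->
     (forall k, B k <> A -> broyden_well_defined (B k) (s k) (A *m s k)) ->
     generated_by (broyden_update theta) A B s ->
     admissible_directions A W B s ->
     reaches_within_dim A B)
  /\
  (forall M : 'M[R]_n,
     is_symmetric_mx M ->
     M \in unitmx ->
     is_symmetric_mx A ->
     (forall k, is_symmetric_mx (B k)) ->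
     generated_by (psb_update M) A B s ->
     admissible_directions A (fun=> invsq M) B s ->
     reaches_within_dim A B)
  /\
  (generated_by (@bgm_update R n) A B s ->
   admissible_directions A (fun=> 1%:M) B s ->
   reaches_within_dim A B).
Proof.
split=> [theta W Wcase symA symB _ wd gen adm|].
  have dotA k x : dot (A *m s k) x = wdot A (s k) x by rewrite dot_mulmxl.
  apply: (reaches_within_dim_of_secant adm) => [k BkA|k BkA|k x BkA Bx sWx].
  - have [sy0 sBs_gt0] := wd k BkA.
    (* Both cases come from well-definedness: for [W = A] the quantity is the denominator [dot s y],
       for [W = B k] it is [wdot B s s]. *)
    by case: Wcase => ->; [rewrite -dot_mulmx | apply: lt0r_neq0].
  - by rewrite gen // broyden_secant //; apply: wd.
  (* On the kernel, [A] and [B k] give the same pairing with [s k], so either choice of [W] makes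
     [x] orthogonal to both [y] and [B k *m s k]. *)
  - have sAB : wdot (B k) (s k) x = wdot A (s k) x by rewrite -!dot_mulmx Bx.
    have sAx : wdot A (s k) x = 0.
      by case: Wcase sWx => ->; rewrite ?sAB.
    by rewrite gen // broyden_fix // ?dotA ?sAB.
split=> [M symM uM symA symB gen adm|gen adm].
  have sNs k : B k <> A -> wdot (invsq M) (s k) (s k) != 0.
    by move=> BkA; have [s0 _] := adm k BkA; rewrite lt0r_neq0 ?wdot_invsq_gt0.
  apply: (reaches_within_dim_of_secant adm) => // [k BkA|k x BkA Bx sNx].
  - by rewrite gen // psb_secant // sNs.
  (* Symmetry of [A] and [B k] moves [A - B k] from [s k] onto [x], where it vanishes. *)
  - by rewrite gen // psb_fix // dotBl !dot_mulmxl // -!dot_mulmx Bx subrr.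
have sIx k x : wdot 1%:M (s k) x = dot (s k) x by rewrite -dot_mulmx mul1mx.
have ss k : B k <> A -> dot (s k) (s k) != 0.
  by move=> BkA; have [s0 _] := adm k BkA; rewrite lt0r_neq0 ?dot_gt0.
apply: (reaches_within_dim_of_secant adm) => [k BkA|k BkA|k x BkA _].
- by rewrite sIx ss.
- by rewrite gen // bgm_update_mul scalerA mulVf ?ss // scale1r addrC subrK.
- by rewrite sIx gen // bgm_update_mul => ->; rewrite scale0r scaler0 addr0.
Qed.
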